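(* Let $\mathbb F$ be a division ring and $A\in\mathbb F^{n\times n}$. The following are equivalent: (1) There exists $\mathbf v\in\mathbb F^{n\times1}$ such that the pair $(A,\mathbf v)$ is controllable. (2) There exists $\mathbf u\in\mathbb F^{1\times n}$ such that the pair $(\mathbf u,A)$ is observable. (3) $A$ is similar to a (left or right) companion matrix. (4) The pencil $z\mathbf I_n-A$ is equivalent over $\mathbb F^{n\times n}[z]$ to a polynomial matrix $\begin{bmatrix}\mathbf I_{n-1}&0\\0&h(z)\end{bmatrix}$ with $h\in\mathbb F[z]$ monic. If this is the case (i.e., if $A$ is cyclic), then: (a) $A\sim C_\ell(\mathfrak P_{A,\mathbf v})\sim C_{\mathbf r}(\mathfrak P_{\mathbf u,A})$ for any right cyclic vector $\mathbf v$ and any left cyclic vector $\mathbf u$ of $A$. (b) If $A=TC_\ell(f)T^{-1}=SC_{\mathbf r}(g)S^{-1}$ for some monic $f,g\in\mathbb F[z]$ of degree $n$ and invertible $T,S\in\mathbb F^{n\times n}$, then the vectors $\mathbf v=T\mathbf e_1$ and $\mathbf u=\mathbf e_1^\top S^{-1}$ are (right and left, respectively) cyclic for $A$, and furthermore $f=\mathfrak P_{A,\mathbf v}$ and $g=\mathfrak P_{\mathbf u,A}$. (c) The polynomial $h$ from part (4) is necessarily of the form $h=\mathfrak P_{A,\mathbf w}$ for some (right) cyclic vector $\mathbf w$ of $A$.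
   Context: $\mathbb F[z]$ is the ring of polynomials over $\mathbb F$ in a formal variable $z$ commuting with the coefficients. $\sim$ denotes similarity of matrices over $\mathbb F$: $A\sim B$ if $B=TAT^{-1}$ for some invertible $T$. $\mathbf e_j$ is the $j$-th column of $\mathbf I_n$. $(A,\mathbf v)$ is controllable, and $\mathbf v$ is called a right cyclic vector of $A$, if $[\mathbf v\ A\mathbf v\ \cdots\ A^{n-1}\mathbf v]$ is invertible; $(\mathbf u,A)$ is observable, and $\mathbf u$ is called a left cyclic vector of $A$, if the matrix with rows $\mathbf u,\mathbf uA,\dots,\mathbf uA^{n-1}$ is invertible. $\mathfrak P_{A,\mathbf v}$ is the monic generator of the right ideal $\{p=\sum p_jz^j\in\mathbb F[z]:\sum_jA^j\mathbf vp_j=0\}$; $\mathfrak P_{\mathbf u,A}$ is the monic generator of the left ideal $\{p=\sum p_jz^j\in\mathbb F[z]:\sum_jp_j\mathbf uA^j=0\}$. For monic $p(z)=z^n+\sum_{k=0}^{n-1}p_kz^k$, the left companion matrix is $C_\ell(p)=[\mathbf e_2\ \cdots\ \mathbf e_n\ \ -\mathbf p]$, $\mathbf p=[p_0\ \cdots\ p_{n-1}]^\top$, and the right companion matrix is $C_{\mathbf r}(p)=C_\ell(p)^\top$. Two matrices over $\mathbb F[z]$ of size $n\times n$ are equivalent over $\mathbb F^{n\times n}[z]$ if one can be transformed into the other by elementary row and column operations over $\mathbb F[z]$ (rows multiplied by scalars from $\mathbb F[z]$ on the left, columns on the right). *)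

(* Defs.v *)
From Stdlib Require Import Relations ClassicalEpsilon.
From HB Require Import structures.
From mathcomp Require Import all_boot all_order all_algebra.

Set Implicit Arguments.
Unset Strict Implicit.
Unset Printing Implicit Defensive.

Import GRing.Theory.
Local Open Scope ring_scope.

(* The base ring is not commutative, so [unitmx], [invmx] and the library's
   matrix similarity are not available: inverses are explicit and two-sided. *)
Definition mx_inverse (R : nzRingType) (n : nat) (T T' : 'M[R]_n) : Prop :=
  T *m T' = 1%:M /\ T' *m T = 1%:M.

Definition mx_invertible (R : nzRingType) (n : nat) (T : 'M[R]_n) : Prop :=
  exists T' : 'M[R]_n, mx_inverse T T'.

Definition similar_mx (R : nzRingType) (n : nat) (A B : 'M[R]_n) : Prop :=
  exists T T' : 'M[R]_n, mx_inverse T T' /\ A = T *m B *m T'.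

Definition controllable (R : nzRingType) (n : nat)
    (A : 'M[R]_n) (v : 'cV[R]_n) : Prop :=
  mx_invertible (\matrix_(i < n, j < n) (A ^+ j *m v) i 0).

Definition observable (R : nzRingType) (n : nat)
    (u : 'rV[R]_n) (A : 'M[R]_n) : Prop :=
  mx_invertible (\matrix_(i < n, j < n) (u *m A ^+ i) 0 j).

(* A column is multiplied by the coefficient p`_j on the right, as a product
   with the 1 x 1 matrix (p`_j)%:M. *)
Definition right_annihilator (R : nzRingType) (n : nat)
    (A : 'M[R]_n) (v : 'cV[R]_n) (p : {poly R}) : Prop :=
  \sum_(j < size p) (A ^+ j *m v) *m (p`_j)%:M = 0.

Definition left_annihilator (R : nzRingType) (n : nat)
    (u : 'rV[R]_n) (A : 'M[R]_n) (p : {poly R}) : Prop :=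
  \sum_(j < size p) p`_j *: (u *m A ^+ j) = 0.

(* I = g R[z] *)
Definition monic_right_generator (R : nzRingType)
    (I : {poly R} -> Prop) (g : {poly R}) : Prop :=
  g \is monic /\ forall p : {poly R}, I p <-> exists q : {poly R}, p = g * q.

(* I = R[z] g *)
Definition monic_left_generator (R : nzRingType)
    (I : {poly R} -> Prop) (g : {poly R}) : Prop :=
  g \is monic /\ forall p : {poly R}, I p <-> exists q : {poly R}, p = q * g.

(* Over a division ring the two annihilators are nonzero one-sided ideals of a
   principal ideal domain, so the monic generators exist and are unique. *)
Definition right_minpoly (R : nzRingType) (n : nat)
    (A : 'M[R]_n) (v : 'cV[R]_n) : {poly R} :=
  epsilon (inhabits 0) (monic_right_generator (right_annihilator A v)).

Definition left_minpoly (R : nzRingType) (n : nat)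
    (u : 'rV[R]_n) (A : 'M[R]_n) : {poly R} :=
  epsilon (inhabits 0) (monic_left_generator (left_annihilator u A)).

(* Companion matrices of a monic p of degree n, i.e. with size p = n.+1; the
   size condition is not part of the definition. When it holds,
   [right_companion] has the same entries as the library's [companionmx]. *)
Definition left_companion (R : nzRingType) (n : nat) (p : {poly R}) : 'M[R]_n :=
  \matrix_(i < n, j < n)
    if j.+1 == n then - p`_i else (i == j.+1 :> nat)%:R.

Definition right_companion (R : nzRingType) (n : nat) (p : {poly R}) : 'M[R]_n :=
  (left_companion n p)^T.

Definition ring_invertible (R : nzRingType) (c : R) : Prop :=
  exists d : R, c * d = 1 /\ d * c = 1.

(* Row operations multiply from the left, column operations from the right. *)
Variant elementary_step (R : nzRingType) (m n : nat) (M : 'M[R]_(m, n)) :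
    'M[R]_(m, n) -> Prop :=
| RowSwap (i k : 'I_m) : elementary_step M (xrow i k M)
| ColSwap (j l : 'I_n) : elementary_step M (xcol j l M)
| RowScale (i : 'I_m) (c : R) of ring_invertible c :
    elementary_step M
      (\matrix_(a, b) if a == i then c * M a b else M a b)
| ColScale (j : 'I_n) (c : R) of ring_invertible c :
    elementary_step M
      (\matrix_(a, b) if b == j then M a b * c else M a b)
| RowAdd (i k : 'I_m) (c : R) of i != k :
    elementary_step M
      (\matrix_(a, b) if a == i then M i b + c * M k b else M a b)
| ColAdd (j l : 'I_n) (c : R) of j != l :
    elementary_step M
      (\matrix_(a, b) if b == j then M a j + M a l * c else M a b).

Definition equivalent_mx (R : nzRingType) (m n : nat) :
    'M[R]_(m, n) -> 'M[R]_(m, n) -> Prop :=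
  clos_refl_trans _ (@elementary_step R m n).

(* diag(1, ..., 1, h) *)
Definition last_diag_mx (R : nzRingType) (n : nat) (h : R) : 'M[R]_n.+1 :=
  diag_mx (\row_(j < n.+1) if j == ord_max then h else 1).

(* Main.v *)
(* A cyclic vector v makes the Krylov matrix K = [v, Av, ...] satisfy
   A K = K C_l(p), with p the monic generator of the annihilator of v; dually for
   rows and C_r. The Hankel matrix of the coefficients of p is invertible and
   intertwines C_l(p) with C_r(p), which exchanges right and left cyclicity.
   Invertible matrices over a division ring are products of elementary ones, so a
   similarity of A with C_l(p) is an equivalence of pencils, and the pencil of
   C_l(p) reduces explicitly to diag(1, ..., 1, p). Conversely z I - A presents
   F^n, with z acting as A, as a right F[z]-module: if the pencil is equivalent
   to diag(1, ..., 1, h), this module is F[z] / h F[z], and the image w of 1 is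
   cyclic with annihilator h F[z]; invariance of dimension gives deg h = n. *)

From Stdlib Require Import Relations ClassicalEpsilon.
Require Import Defs.
From HB Require Import structures.
From mathcomp Require Import all_boot all_order all_algebra perm.

Set Implicit Arguments.
Unset Strict Implicit.
Unset Printing Implicit Defensive.

Import GRing.Theory.
Local Open Scope ring_scope.

(** * Inverses and similarity *)

Section Similarity.
Variables (R : nzRingType) (n : nat).
Implicit Types A B C S T : 'M[R]_n.

Lemma mx_inverse_sym T T' : mx_inverse T T' -> mx_inverse T' T.
Proof. by case. Qed.

Lemma mx_inverse1 : mx_inverse (1%:M : 'M[R]_n) 1%:M.
Proof. by rewrite /mx_inverse mulmx1. Qed.

Lemma mx_inverseM S S' T T' :
  mx_inverse S S' -> mx_inverse T T' -> mx_inverse (S *m T) (T' *m S').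
Proof.
move=> [SS' S'S] [TT' T'T]; split.
  by rewrite mulmxA -(mulmxA S) TT' mulmx1.
by rewrite mulmxA -(mulmxA T') S'S mulmx1.
Qed.

(** L = L (T L') = (L T) L' = L', so a left and a right inverse coincide. *)
Lemma mx_inverse_left_right T L L' :
  L *m T = 1%:M -> T *m L' = 1%:M -> mx_inverse T L'.
Proof.
move=> LT TL'; split=> //.
by rewrite -{1}(mul1mx L') -LT -(mulmxA L) TL' mulmx1.
Qed.

Lemma similar_mx_sym A B : similar_mx A B -> similar_mx B A.
Proof.
move=> [T [T' [[TT' T'T] ->]]]; exists T', T; split=> //.
by rewrite !mulmxA T'T mul1mx -mulmxA T'T mulmx1.
Qed.

Lemma similar_mx_trans A B C : similar_mx A B -> similar_mx B C -> similar_mx A C.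
Proof.
move=> [S [S' [invS ->]]] [T [T' [invT ->]]]; exists (S *m T), (T' *m S').
by split; [exact: mx_inverseM | rewrite !mulmxA].
Qed.

Lemma mx_inverse_conj A B T T' :
  mx_inverse T T' -> A *m T = T *m B -> A = T *m B *m T'.
Proof. by move=> [TT' _] <-; rewrite -mulmxA TT' mulmx1. Qed.

Lemma mx_inverse_conjr A B T T' :
  mx_inverse T T' -> T *m A = B *m T -> A = T' *m B *m T.
Proof. by move=> [_ T'T] TA; rewrite -mulmxA -TA mulmxA T'T mul1mx. Qed.

End Similarity.

(** * Products of elementary matrices *)

Section Elementary.
Variable R : nzRingType.

Definition scale_mx n (i : 'I_n) (c : R) : 'M[R]_n :=
  diag_mx (\row_j if j == i then c else 1).

Inductive elementary_product n : 'M[R]_n -> Prop :=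
| elementary1 : elementary_product 1%:M
| elementary_swap i j : elementary_product (tperm_mx i j)
| elementary_scale i c : ring_invertible c -> elementary_product (scale_mx i c)
| elementary_add i j c : i != j -> elementary_product (1%:M + c *: delta_mx i j)
| elementaryM P Q :
    elementary_product P -> elementary_product Q -> elementary_product (P *m Q).

Lemma mul_scale_mx m n (i : 'I_m) c (M : 'M[R]_(m, n)) :
  scale_mx i c *m M = \matrix_(a, b) if a == i then c * M a b else M a b.
Proof.
by apply/matrixP=> a b; rewrite mul_diag_mx !mxE; case: eqP => _; rewrite ?mul1r.
Qed.

Lemma mul_mx_scale m n (j : 'I_n) c (M : 'M[R]_(m, n)) :
  M *m scale_mx j c = \matrix_(a, b) if b == j then M a b * c else M a b.
Proof.
by apply/matrixP=> a b; rewrite mul_mx_diag !mxE; case: eqP => _; rewrite ?mulr1.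
Qed.

Lemma mul_add_mx m n (i k : 'I_m) c (M : 'M[R]_(m, n)) :
  (1%:M + c *: delta_mx i k) *m M
  = \matrix_(a, b) if a == i then M i b + c * M k b else M a b.
Proof.
apply/matrixP=> a b; rewrite mulmxDl mul1mx -scalemxAl !mxE.
rewrite (bigD1 k) //= big1 ?addr0 => [|l nlk]; last first.
  by rewrite !mxE (negPf nlk) andbF mul0r.
by rewrite !mxE eqxx andbT; case: eqP => [->|_]; rewrite ?mul1r // mul0r mulr0 addr0.
Qed.

Lemma mul_mx_add m n (j l : 'I_n) c (M : 'M[R]_(m, n)) :
  M *m (1%:M + c *: delta_mx l j)
  = \matrix_(a, b) if b == j then M a j + M a l * c else M a b.
Proof.
apply/matrixP=> a b; rewrite mulmxDr mulmx1 !mxE.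
rewrite (bigD1 l) //= big1 ?addr0 => [|k nkl]; last first.
  by rewrite !mxE (negPf nkl) mulr0 mulr0.
by rewrite !mxE eqxx /=; case: eqP => [->|_]; rewrite ?mulr1 // !mulr0 addr0.
Qed.

Lemma elementary_product_inv n (P : 'M[R]_n) :
  elementary_product P -> mx_invertible P.
Proof.
elim=> {P} [|i j|i c [d [cd dc]]|i j c neq|P Q _ [P' invP] _ [Q' invQ]].
- by exists 1%:M; exact: mx_inverse1.
- have sq : tperm_mx i j *m tperm_mx i j = 1%:M :> 'M[R]_n.
    by rewrite /tperm_mx -perm_mxM tperm2 perm_mx1.
  by exists (tperm_mx i j).
- have mulC x y : scale_mx i x *m scale_mx i y = scale_mx i (x * y) :> 'M[R]_n.
    apply/matrixP=> a b; rewrite mul_scale_mx !mxE.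
    by case: eqP => _ //; rewrite mulrnAr.
  have one : scale_mx i 1 = 1%:M :> 'M[R]_n.
    by apply/matrixP=> a b; rewrite !mxE; case: eqP.
  by exists (scale_mx i d); split; rewrite mulC ?cd ?dc.
(* As i and j differ, [delta_mx i j] squares to zero, so transvections at (i, j) add their
   parameters. *)
- have mulA x y : (1%:M + x *: delta_mx i j) *m (1%:M + y *: delta_mx i j)
      = 1%:M + (x + y) *: delta_mx i j :> 'M[R]_n.
    rewrite mulmxDr mulmx1 mul_add_mx; apply/matrixP=> a b; rewrite !mxE.
    rewrite [j == i]eq_sym (negPf neq) /= !mulr0 addr0.
    by rewrite mulrDl addrA; case: (a =P i) => [->|_]; rewrite ?eqxx.
  exists (1%:M + (- c) *: delta_mx i j).
  by split; rewrite mulA ?subrr ?addNr scale0r addr0.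
- by exists (Q' *m P'); exact: mx_inverseM.
Qed.

Lemma equivalent_mx_trans m n (L M N : 'M[R]_(m, n)) :
  equivalent_mx L M -> equivalent_mx M N -> equivalent_mx L N.
Proof. exact: rt_trans. Qed.

Lemma equivalent_elementary_row m n (P : 'M[R]_m) (M : 'M[R]_(m, n)) :
  elementary_product P -> equivalent_mx M (P *m M).
Proof.
move=> eP; elim: eP M => {P} [|i j|i c ic|i j c neq|P Q _ IHP _ IHQ] M.
- by rewrite mul1mx; apply: rt_refl.
- by rewrite -xrowE; apply: rt_step; constructor.
- by rewrite mul_scale_mx; apply: rt_step; constructor.
- by rewrite mul_add_mx; apply: rt_step; constructor.
- by rewrite -mulmxA; apply: equivalent_mx_trans (IHQ M) (IHP _).
Qed.

Lemma equivalent_elementary_col m n (Q : 'M[R]_n) (M : 'M[R]_(m, n)) :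
  elementary_product Q -> equivalent_mx M (M *m Q).
Proof.
move=> eP; elim: eP M => {Q} [|i j|i c ic|i j c neq|P Q _ IHP _ IHQ] M.
- by rewrite mulmx1; apply: rt_refl.
- by rewrite -xcolE; apply: rt_step; constructor.
- by rewrite mul_mx_scale; apply: rt_step; constructor.
- by rewrite mul_mx_add; apply: rt_step; constructor; rewrite eq_sym.
- by rewrite mulmxA; apply: equivalent_mx_trans (IHP M) (IHQ _).
Qed.

(** Row steps collect into a left factor and column steps into a right one. Both factors are
    invertible, which lets an equivalence of pencils be read as an isomorphism of the presented
    modules. *)
Lemma equivalent_mxP m n (M N : 'M[R]_(m, n)) :
  equivalent_mx M N ->
  exists P Q, [/\ elementary_product P, elementary_product Q & N = P *m M *m Q].
Proof.
elim=> {M N} [M N|M|L M N _ [P [Q [eP eQ ->]]] _ [P' [Q' [eP' eQ' ->]]]].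
- case=> [i k|j l|i c ic|j c ic|i k c neq|j l c neq].
  + exists (tperm_mx i k), 1%:M; rewrite mulmx1 -xrowE.
    by split=> //; constructor.
  + exists 1%:M, (tperm_mx j l); rewrite mul1mx -xcolE.
    by split=> //; constructor.
  + exists (scale_mx i c), 1%:M; rewrite mulmx1 mul_scale_mx.
    by split=> //; constructor.
  + exists 1%:M, (scale_mx j c); rewrite mul1mx mul_mx_scale.
    by split=> //; constructor.
  + exists (1%:M + c *: delta_mx i k), 1%:M; rewrite mulmx1 mul_add_mx.
    by split=> //; constructor.
  + exists 1%:M, (1%:M + c *: delta_mx l j); rewrite mul1mx mul_mx_add.
    by split=> //; constructor; rewrite // eq_sym.
- by exists 1%:M, 1%:M; rewrite mulmx1 mul1mx; split=> //; constructor.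
- exists (P' *m P), (Q *m Q'); split; [exact: elementaryM | exact: elementaryM |].
  by rewrite !mulmxA.
Qed.

(** Nonzero entries of N have row index in D and column index outside D, so their matrix units
    multiply to zero pairwise and 1 + N is the product of the transvections read off entry by
    entry. *)
Lemma elementary_block_unipotent n (D : pred 'I_n) (N : 'M[R]_n) :
  (forall i j, ~~ (D i && ~~ D j) -> N i j = 0) -> elementary_product (1%:M + N).
Proof.
move=> N0.
pose part (s : seq ('I_n * 'I_n)) : 'M[R]_n :=
  \sum_(p <- s | D p.1 && ~~ D p.2) N p.1 p.2 *: delta_mx p.1 p.2.
have -> : N = part (index_enum ('I_n * 'I_n)%type).
  rewrite {1}[N]matrix_sum_delta pair_bigA /part.
  rewrite [LHS](bigID (fun p => D p.1 && ~~ D p.2)) /=.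
  by rewrite [X in _ + X]big1 ?addr0 // => p /N0 ->; rewrite scale0r.
elim: (index_enum _) => [|[i j] s IH]; rewrite /part ?big_nil ?addr0.
  by constructor.
rewrite big_cons -/(part s) /=; case: ifP => [/andP[Di nDj]|_ //].
have z : delta_mx i j *m part s = 0.
  rewrite mulmx_sumr big1 // => -[i' j'] /= /andP[Di' _].
  apply/matrixP=> a b; rewrite !mxE big1 // => l _; rewrite !mxE.
  case: (l =P j) => [->|_]; last by rewrite andbF mul0r.
  by case: (j =P i') => [eqj|_]; [rewrite eqj Di' in nDj | rewrite mulr0 mulr0].
suff -> : 1%:M + (N i j *: delta_mx i j + part s)
    = (1%:M + N i j *: delta_mx i j) *m (1%:M + part s).
  by apply: elementaryM => //; constructor; apply: contraNneq nDj => <-.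
by rewrite mulmxDr mulmx1 mulmxDl mul1mx -scalemxAl z scaler0 addr0 addrA.
Qed.

End Elementary.

(** * Unitriangular matrices as products of transvections *)

Section Unitriangular.
Variable R : nzRingType.

(* Column by column: adding the column k of U to a matrix whose k-th row is
   the k-th row of the identity is left multiplication by a transvection. *)
Lemma elementary_upper_unitriangular n (U : 'M[R]_n) :
  (forall i j : 'I_n, (j <= i)%N -> U i j = (i == j)%:R) -> elementary_product U.
Proof.
move=> triU.
pose V k := \matrix_(i < n, j < n) if (j < k)%N then U i j else (i == j)%:R.
suff eV k : (k <= n)%N -> elementary_product (V k).
  have -> : U = V n by apply/matrixP=> i j; rewrite mxE ltn_ord.
  exact: eV.
elim: k => [_|k IH ltkn].
  suff -> : V 0 = 1%:M by constructor.
  by apply/matrixP=> i j; rewrite !mxE.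
pose o := Ordinal ltkn; pose u : 'cV[R]_n := \col_i (U i o - (i == o)%:R).
suff -> : V k.+1 = (1%:M + u *m delta_mx 0 o) *m V k.
  apply: elementaryM; last exact: IH (ltnW ltkn).
  apply: (elementary_block_unipotent (D := predC1 o)) => i j.
  rewrite !mxE big_ord1 !mxE /= negbK; case: (j =P o) => _; last by rewrite mulr0.
  by rewrite andbT negbK => /eqP ->; rewrite triU // eqxx subrr mul0r.
rewrite mulmxDl mul1mx -mulmxA -rowE.
apply/matrixP=> i j; rewrite !mxE big_ord1 !mxE ltnS leq_eqVlt.
have eqjk : (j == k :> nat) = (o == j) by rewrite eq_sym.
rewrite eqjk; case: (o =P j) => [<-|neq] /=.
  by rewrite ltnn mulr1 addrC subrK.
case: ifP => ltjk; rewrite ?mulr0 ?addr0 //.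
by rewrite (triU o j (ltnW ltjk)) (introF eqP neq) mulr0 addr0.
Qed.

End Unitriangular.

(** * Elimination over a division ring *)

Section DivisionRing.
Variable F : unitRingType.
Hypothesis F_division : forall x : F, x != 0 -> x \is a GRing.unit.

(** Gaussian elimination on columns, one row at a time: after k rounds the first k rows of T E are
    those of the identity. The right inverse guarantees a pivot in row k. *)
Lemma right_invertible_elementary n (T T' : 'M[F]_n) :
  T *m T' = 1%:M -> exists2 E, elementary_product E & T *m E = 1%:M.
Proof.
move=> TT'.
suff red k : (k <= n)%N -> exists2 E, elementary_product E
    & forall i j : 'I_n, (i < k)%N -> (T *m E) i j = (i == j)%:R.
  have [//|E eE TE] := red n; exists E => //.
  by apply/matrixP=> i j; rewrite TE // mxE.
elim: k => [_|k IH ltkn]; first by exists 1%:M => //; constructor.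
have [E eE TE] := IH (ltnW ltkn).
have [E' [EE' _]] := elementary_product_inv eE.
pose o := Ordinal ltkn; set S := T *m E in TE.
have defS : S = T *m E by []; clearbody S.
(* If the entries (k, j) with k <= j all vanished, the row k would be a
   combination of the previous rows. *)
have [j lekj Soj] : exists2 j : 'I_n, (k <= j)%N & S o j != 0.
  apply/exists_inP; apply: contraT => /exists_inPn S0.
  (* u has entry 1 at position k and cancels row k of S by the unit rows above it, so u S = 0; but S
     E' T' = 1 gives u = u S E' T'. *)
  pose u : 'rV[F]_n := \row_j (if (j < k)%N then - S o j else (o == j)%:R).
  have uS : u *m S = 0.
    apply/rowP=> j; rewrite !mxE (bigD1 o) //= !mxE ltnn eqxx mul1r.
    have [ltjk|lekj] := ltnP j k; last first.
      have /negPn/eqP -> := S0 j lekj; rewrite add0r big1 // => i nio.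
      rewrite !mxE; case: ifP => ltik; last by rewrite eq_sym (negPf nio) mul0r.
      have nij : i != j by apply: contraTneq ltik => ->; rewrite -leqNgt.
      by rewrite (TE i j) // (negPf nij) mulr0.
    have njo : j != o by apply: contraTneq ltjk => ->; rewrite ltnn.
    rewrite (bigD1 j) //= big1 => [|i /andP[nio nij]]; last first.
      rewrite mxE; case: ifP => ltik; last by rewrite eq_sym (negPf nio) mul0r.
      by rewrite (TE i j) // (negPf nij) mulr0.
    by rewrite mxE ltjk (TE j j) // eqxx mulr1 addr0 subrr.
  have : u *m S *m (E' *m T') = u.
    by rewrite defS !mulmxA -(mulmxA (u *m T)) EE' mulmx1 -mulmxA TT' mulmx1.
  rewrite uS mul0mx => /rowP/(_ o); rewrite !mxE ltnn eqxx.
  by move/esym/eqP; rewrite oner_eq0.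

(* Bring the pivot to the diagonal and divide its column by it on the right. Both swapped columns
   have index at least k, where the earlier rows vanish. *)
have ej : elementary_product (tperm_mx o j *m scale_mx o (S o j)^-1).
  apply: elementaryM; constructor.
  by exists (S o j); rewrite mulVr ?divrr ?F_division.
set P := _ *m _ in ej; set Q := S *m P.
have QE (i l : 'I_n) : (i < k)%N -> Q i l = (i == l)%:R.
  move=> ltik; have nio : i != o by apply: contraTneq ltik => ->; rewrite ltnn.
  have nij : i != j by apply: contraTneq ltik => ->; rewrite -leqNgt.
  rewrite /Q /P mulmxA -xcolE mul_mx_scale !mxE TE //.
  have [->|nlo] := eqVneq l o; first by rewrite tpermL (negPf nij) (negPf nio) mul0r.
  by case: tpermP nlo => [->|->|//]; rewrite ?eqxx // (negPf nij) (negPf nio).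
have Qoo : Q o o = 1.
  by rewrite /Q /P mulmxA -xcolE mul_mx_scale !mxE eqxx tpermL mulrV ?F_division.
have defQ : Q = T *m (E *m P) by rewrite mulmxA -defS.
clearbody Q.
(* Subtracting column k times [Q o b] from every other column b clears row k off the diagonal. *)
pose N := \matrix_(a, b) (if (a == o) && (b != o) then - Q o b else 0) : 'M[F]_n.
exists (E *m P *m (1%:M + N)).
  apply: elementaryM; first exact: elementaryM.
  apply: (elementary_block_unipotent (D := pred1 o)) => a b /negPf nab.
  by rewrite mxE nab.
move=> i l ltik; rewrite mulmxA -defQ mulmxDr mulmx1 mxE [X in _ + X]mxE.
rewrite (bigD1 o) //= big1 ?addr0 => [|a nao]; last by rewrite mxE (negPf nao) mulr0.
rewrite mxE eqxx /=; move: ltik; rewrite ltnS leq_eqVlt => /predU1P[eqik|ltik].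
  have -> : i = o by apply: val_inj.
  rewrite Qoo mul1r eq_sym; case: eqP => [<-|_] /=; first by rewrite Qoo addr0.
  by rewrite subrr.
have nio : i != o by apply: contraTneq ltik => ->; rewrite ltnn.
by rewrite (QE i l) // (QE i o) // (negPf nio) mul0r addr0.
Qed.

(** From T E = 1 with E invertible, T is the inverse of E, so E is also a left inverse of T. *)
Lemma right_invertible_inverse n (T T' : 'M[F]_n) : T *m T' = 1%:M -> mx_inverse T T'.
Proof.
move=> TT'; have [E eE TE] := right_invertible_elementary TT'.
have [E' [EE' E'E]] := elementary_product_inv eE.
apply: mx_inverse_left_right TT'.
by rewrite -[T]mulmx1 -EE' (mulmxA T) TE mul1mx.
Qed.

(** Elimination is applied to T' instead of T: from T' E = 1 follows E = T T' E = T. *)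
Lemma mx_inverse_elementary n (T T' : 'M[F]_n) :
  mx_inverse T T' -> elementary_product T.
Proof.
move=> [TT' T'T]; have [E eE T'E] := right_invertible_elementary T'T.
by rewrite -[T]mulmx1 -T'E mulmxA TT' mul1mx.
Qed.

(** If n < m, zero columns added to A and zero rows added to B give square matrices with product 1.
    The reversed product would be 1 as well, but its lower right block is zero. *)
Lemma mulmx1_leq m n (A : 'M[F]_(m, n)) (B : 'M[F]_(n, m)) :
  A *m B = 1%:M -> (m <= n)%N.
Proof.
move=> AB; rewrite leqNgt; apply/negP => /subnKC eqm; move: A B AB; rewrite -eqm.
set k := (m - _.+1)%N; rewrite addSnnS => A B AB.
have : row_mx A (0 : 'M_(n + k.+1, k.+1)) *m col_mx B 0 = 1%:M.
  by rewrite mul_row_col mul0mx addr0.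
case/right_invertible_inverse => _.
rewrite mul_col_row mulmx0 scalar_mx_block => /eq_block_mx[_ _ _].
by rewrite mul0mx => /matrixP/(_ 0 0); rewrite !mxE => /esym/eqP; rewrite oner_eq0.
Qed.

End DivisionRing.

(** * Evaluation at a matrix and its annihilators *)

Section RightAction.
Variables (R : nzRingType) (n : nat) (A : 'M[R]_n).
Implicit Types (v : 'cV[R]_n) (p q : {poly R}).

(* v . p for the right R[z]-module structure on column vectors where z acts as A *)
Definition ract v p : 'cV[R]_n := \sum_(j < size p) (A ^+ j *m v) *m (p`_j)%:M.

Lemma ract_widen v p m :
  (size p <= m)%N -> ract v p = \sum_(j < m) (A ^+ j *m v) *m (p`_j)%:M.
Proof.
move=> lepm; rewrite /ract.
rewrite (big_ord_widen _ (fun j => A ^+ j *m v *m (p`_j)%:M) lepm) big_mkcond.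
apply: eq_bigr => j _; case: ltnP => // lepj.
by rewrite nth_default // raddf0 mulmx0.
Qed.

Lemma ractD v p q : ract v (p + q) = ract v p + ract v q.
Proof.
have [lep leq] := (leq_maxl (size p) (size q), leq_maxr (size p) (size q)).
rewrite (ract_widen v lep) (ract_widen v leq) (ract_widen v (size_polyD p q)).
by rewrite -big_split; apply: eq_bigr => j _; rewrite coefD raddfD mulmxDr.
Qed.

Lemma ract0 v : ract v 0 = 0.
Proof. by rewrite /ract size_poly0 big_ord0. Qed.

Lemma ractN v p : ract v (- p) = - ract v p.
Proof. by apply: (addrI (ract v p)); rewrite -ractD !subrr ract0. Qed.

Lemma ract_sum v I (r : seq I) (P : pred I) (f : I -> {poly R}) :
  ract v (\sum_(i <- r | P i) f i) = \sum_(i <- r | P i) ract v (f i).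
Proof. exact: (big_morph _ (ractD v) (ract0 v)). Qed.

Lemma ractDl v w p : ract (v + w) p = ract v p + ract w p.
Proof. by rewrite -big_split; apply: eq_bigr => j _; rewrite mulmxDr mulmxDl. Qed.

Lemma ract0l p : ract 0 p = 0.
Proof. by rewrite /ract big1 // => j _; rewrite mulmx0 mul0mx. Qed.

Lemma ract_suml I (r : seq I) (P : pred I) (f : I -> 'cV[R]_n) p :
  ract (\sum_(i <- r | P i) f i) p = \sum_(i <- r | P i) ract (f i) p.
Proof. exact: (big_morph (ract^~ p) (fun v w => ractDl v w p) (ract0l p)). Qed.

Lemma ractC v c : ract v c%:P = v *m c%:M.
Proof.
by rewrite (ract_widen v (size_polyC_leq1 c)) big_ord1 expr0 mul1mx coefC.
Qed.

Lemma ractMC v p c : ract v (p * c%:P) = ract v p *m c%:M.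
Proof.
have le : (size (p * c%:P)%R <= size p)%N.
  by apply/leq_sizeP => j lepj; rewrite coefMC nth_default ?mul0r.
rewrite (ract_widen v le) mulmx_suml; apply: eq_bigr => j _.
by rewrite coefMC scalar_mxM mulmxA.
Qed.

Lemma ractMX v p : ract v (p * 'X) = A *m ract v p.
Proof.
have le : (size (p * 'X)%R <= (size p).+1)%N.
  by apply/leq_sizeP => -[|j] lepj //; rewrite coefMX /= nth_default.
rewrite (ract_widen v le) big_ord_recl coefMX raddf0 mulmx0 add0r mulmx_sumr.
apply: eq_bigr => j _; rewrite coefMX exprS !mulmxA //.
Qed.

Lemma ractXn v k : ract v 'X^k = A ^+ k *m v.
Proof.
elim: k => [|k IH]; first by rewrite ractC mulmx1 mul1mx.
by rewrite exprSr ractMX IH mulmxA mulmxE -exprS.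
Qed.

Lemma ractM v p q : ract v (p * q) = ract (ract v p) q.
Proof.
elim/poly_ind: q => [|q c IH]; first by rewrite mulr0 !ract0.
by rewrite mulrDr mulrA !ractD ractMX IH ractMC ractMX ractC.
Qed.

Lemma right_annihilatorE v p : right_annihilator A v p <-> ract v p = 0.
Proof. by []. Qed.

End RightAction.

(** * The mirror action of polynomials on row vectors *)

Section LeftAction.
Variables (R : nzRingType) (n : nat) (A : 'M[R]_n).
Implicit Types (u : 'rV[R]_n) (p q : {poly R}).

Definition lact u p : 'rV[R]_n := \sum_(j < size p) p`_j *: (u *m A ^+ j).

Lemma lact_widen u p m :
  (size p <= m)%N -> lact u p = \sum_(j < m) p`_j *: (u *m A ^+ j).
Proof.
move=> lepm; rewrite /lact.
rewrite (big_ord_widen _ (fun j => p`_j *: (u *m A ^+ j)) lepm) big_mkcond.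
apply: eq_bigr => j _; case: ltnP => // lepj.
by rewrite nth_default // scale0r.
Qed.

Lemma lactD u p q : lact u (p + q) = lact u p + lact u q.
Proof.
have [lep leq] := (leq_maxl (size p) (size q), leq_maxr (size p) (size q)).
rewrite (lact_widen u lep) (lact_widen u leq) (lact_widen u (size_polyD p q)).
by rewrite -big_split; apply: eq_bigr => j _; rewrite coefD scalerDl.
Qed.

Lemma lact0 u : lact u 0 = 0.
Proof. by rewrite /lact size_poly0 big_ord0. Qed.

Lemma lact0l p : lact 0 p = 0.
Proof. by rewrite /lact big1 // => j _; rewrite mul0mx scaler0. Qed.

Lemma lactC u c : lact u c%:P = c *: u.
Proof.
by rewrite (lact_widen u (size_polyC_leq1 c)) big_ord1 expr0 mulmx1 coefC.
Qed.

Lemma lactCM u p c : lact u (c%:P * p) = c *: lact u p.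
Proof.
have le : (size (c%:P * p)%R <= size p)%N.
  by apply/leq_sizeP => j lepj; rewrite coefCM nth_default ?mulr0.
rewrite (lact_widen u le) scaler_sumr; apply: eq_bigr => j _.
by rewrite coefCM scalerA.
Qed.

Lemma lactMX u p : lact u (p * 'X) = lact u p *m A.
Proof.
have le : (size (p * 'X)%R <= (size p).+1)%N.
  by apply/leq_sizeP => -[|j] lepj //; rewrite coefMX /= nth_default.
rewrite (lact_widen u le) big_ord_recl coefMX scale0r add0r mulmx_suml.
by apply: eq_bigr => j _; rewrite coefMX -scalemxAl -mulmxA exprSr.
Qed.

Lemma lactXn u k : lact u 'X^k = u *m A ^+ k.
Proof.
elim: k => [|k IH]; first by rewrite lactC scale1r mulmx1.
by rewrite exprSr lactMX IH -mulmxA mulmxE -exprSr.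
Qed.

Lemma lactM u p q : lact u (q * p) = lact (lact u p) q.
Proof.
elim/poly_ind: q => [|q c IH]; first by rewrite mul0r !lact0.
(* ['X] is central, so (q z) p = (q p) z. *)
by rewrite mulrDl -mulrA -commr_polyX mulrA !lactD lactMX IH lactCM lactMX lactC.
Qed.

End LeftAction.

(** * One-sided division and uniqueness of monic generators *)

Section MonicGenerator.
Variable R : nzRingType.
Implicit Types (f g p q : {poly R}) (I : {poly R} -> Prop).

(** The quotient stands to the right of g, as right ideals require. In the Horner step the new
    remainder r z + c has size at most that of g; since g is monic, subtracting g l removes its top
    coefficient l. *)
Lemma monic_left_division g p :
  g \is monic -> exists q r, p = g * q + r /\ (size r < size g)%N.
Proof.
move=> mg; elim/poly_ind: p => [|p c [q [r [-> ltrg]]]].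
  by exists 0, 0; rewrite mulr0 addr0 size_poly0 size_poly_gt0 monic_neq0.
pose s := r * 'X + c%:P; pose l := s`_(size g).-1.
have size_g : size g = (size g).-1.+1 by rewrite prednK // size_poly_gt0 monic_neq0.
exists (q * 'X + l%:P), (s - g * l%:P); split.
  rewrite mulrDr mulrA mulrDl -!addrA; congr (_ + _).
  by rewrite [r * 'X + (_ - _)]addrA addrCA subrr addr0.
rewrite size_g ltnS; apply/leq_sizeP => j.
rewrite coefB coefMC leq_eqVlt => /predU1P[<-|ltgj].
  by rewrite -lead_coefE (monicP mg) mul1r subrr.
rewrite [g`_j]nth_default ?mul0r ?subr0; last by rewrite size_g.
case: j ltgj => // j; rewrite ltnS => legj.
rewrite /s coefD coefMX coefC /= addr0 nth_default //.
by apply: leq_trans legj; rewrite -ltnS -size_g.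
Qed.

(** Degree count for two generators that divide each other, with cofactors q and r: the degrees of f
    and g agree, so q is constant. Monicity then makes q equal to 1. *)
Lemma size_cofactor (f g q r : {poly R}) : f \is monic -> r != 0 ->
  size f = (size g + size q).-1 -> size g = (size f + size r).-1 -> (size q <= 1)%N.
Proof.
move=> /monic_neq0; rewrite -!size_poly_gt0 => f0 r0 sf sg.
have lefg : (size f <= size g)%N by rewrite sg -(prednK r0) addnS leq_addr.
rewrite -(leq_add2l (size g)) addn1; apply: leq_trans (_ : _ <= (size f).+1)%N _ => //.
by rewrite sf leqSpred.
Qed.

Lemma monic_right_generator_unique I f g :
  monic_right_generator I f -> monic_right_generator I g -> f = g.
Proof.
move=> [mf If] [mg Ig].
have [q fE] : exists q, f = g * q by apply/Ig/If; exists 1; rewrite mulr1.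
have [r gE] : exists r, g = f * r by apply/If/Ig; exists 1; rewrite mulr1.
have q1 : lead_coef q = 1 by rewrite -(lead_coef_monicM q mg) -fE (monicP mf).
have q0 : q != 0 by rewrite -lead_coef_eq0 q1 oner_eq0.
have r0 : r != 0.
  by apply: contraTneq mg => r0; rewrite gE r0 mulr0 monicE lead_coef0 eq_sym oner_eq0.
have sf : size f = (size g + size q).-1 by rewrite fE size_monicM.
have sg : size g = (size f + size r).-1 by rewrite {1}gE size_monicM.
have := q1; rewrite fE (size1_polyC (size_cofactor mf r0 sf sg)) lead_coefC => ->.
by rewrite mulr1.
Qed.

Lemma monic_left_generator_unique I f g :
  monic_left_generator I f -> monic_left_generator I g -> f = g.
Proof.
move=> [mf If] [mg Ig].
have [q fE] : exists q, f = q * g by apply/Ig/If; exists 1; rewrite mul1r.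
have [r gE] : exists r, g = r * f by apply/If/Ig; exists 1; rewrite mul1r.
have q1 : lead_coef q = 1 by rewrite -(lead_coef_Mmonic q mg) -fE (monicP mf).
have q0 : q != 0 by rewrite -lead_coef_eq0 q1 oner_eq0.
have r0 : r != 0.
  by apply: contraTneq mg => r0; rewrite gE r0 mul0r monicE lead_coef0 eq_sym oner_eq0.
have sf : size f = (size g + size q).-1 by rewrite addnC fE size_Mmonic.
have sg : size g = (size f + size r).-1 by rewrite addnC {1}gE size_Mmonic.
have := q1; rewrite fE (size1_polyC (size_cofactor mf r0 sf sg)) lead_coefC => ->.
by rewrite mul1r.
Qed.

End MonicGenerator.

(** * Krylov matrices and companion matrices *)

Lemma ltn_succ_not_max n (k : 'I_n.+1) : k != ord_max -> (k.+1 < n.+1)%N.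
Proof.
move=> nkm; rewrite ltn_neqAle ltn_ord andbT.
by apply: contra nkm => /eqP[/= kn]; apply/eqP/val_inj.
Qed.

Lemma col_mulmx (R : nzRingType) m n p (A : 'M[R]_(m, n)) (B : 'M_(n, p)) j :
  col j (A *m B) = A *m col j B.
Proof. by rewrite !colE mulmxA. Qed.

Lemma col_matrixP (R : nzRingType) m n (A B : 'M[R]_(m, n)) :
  (forall j, col j A = col j B) <-> A = B.
Proof.
split=> [eqAB | -> //]; apply/matrixP=> i j.
by move/colP/(_ i): (eqAB j); rewrite !mxE.
Qed.

Section Companion.
Variables (R : nzRingType) (n : nat).
Implicit Types (A T : 'M[R]_n.+1) (v : 'cV[R]_n.+1) (u : 'rV[R]_n.+1) (p : {poly R}).

Definition krylov_mx A v : 'M[R]_n.+1 := \matrix_(i, j) (A ^+ j *m v) i 0.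
Definition observability_mx u A : 'M[R]_n.+1 := \matrix_(i, j) (u *m A ^+ i) 0 j.

Lemma col_krylov A v j : col j (krylov_mx A v) = A ^+ j *m v.
Proof. by apply/colP=> i; rewrite !mxE. Qed.

Lemma row_observability u A i : row i (observability_mx u A) = u *m A ^+ i.
Proof. by apply/rowP=> j; rewrite !mxE. Qed.

Lemma col_left_companion_lt p (j j' : 'I_n.+1) : j.+1 = j' :> nat ->
  col j (left_companion n.+1 p) = delta_mx j' 0.
Proof.
move=> jj'; apply/colP=> i; rewrite !mxE jj' eqxx andbT.
by rewrite -val_eqE ltn_eqF.
Qed.

Lemma col_left_companion_max p :
  col ord_max (left_companion n.+1 p) = - \col_(i < n.+1) p`_i.
Proof. by apply/colP=> i; rewrite !mxE eqxx. Qed.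

Lemma mul_mx_left_companion_lt T p (j j' : 'I_n.+1) : j.+1 = j' :> nat ->
  col j (T *m left_companion n.+1 p) = col j' T.
Proof. by move=> jj'; rewrite col_mulmx (col_left_companion_lt p jj') -colE. Qed.

Lemma row_right_companion p i :
  row i (right_companion n.+1 p) = (col i (left_companion n.+1 p))^T.
Proof. by rewrite tr_col. Qed.

Lemma mul_right_companion_mx_lt T p (i i' : 'I_n.+1) : i.+1 = i' :> nat ->
  row i (right_companion n.+1 p *m T) = row i' T.
Proof.
move=> ii'; rewrite row_mul row_right_companion (col_left_companion_lt p ii').
by rewrite trmx_delta -rowE.
Qed.

(** Before the last column, the relation says that A maps each column of T to the next one, so the
    first column generates T. *)
Lemma companion_krylov A T p :
  A *m T = T *m left_companion n.+1 p -> T = krylov_mx A (T *m delta_mx 0 0).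
Proof.
move=> AT; apply/col_matrixP=> j; case: j => j ltj.
rewrite col_krylov /=; elim: j ltj => [|j IH] ltj.
  by rewrite mul1mx -colE; congr (col _ T); apply: val_inj.
have jj : (Ordinal (ltnW ltj)).+1 = Ordinal ltj :> nat by [].
by rewrite -(mul_mx_left_companion_lt T p jj) -AT col_mulmx IH exprS mulmxA.
Qed.

Lemma companion_observability A T p :
  T *m A = right_companion n.+1 p *m T -> T = observability_mx (delta_mx 0 0 *m T) A.
Proof.
move=> TA; apply/row_matrixP=> i; case: i => i lti.
rewrite row_observability /=; elim: i lti => [|i IH] lti.
  by rewrite mulmx1 -rowE; congr (row _ T); apply: val_inj.
have ii : (Ordinal (ltnW lti)).+1 = Ordinal lti :> nat by [].
by rewrite -(mul_right_companion_mx_lt T p ii) -TA row_mul IH exprSr mulmxA.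
Qed.

Definition monic_of_coefs (c : 'I_n.+1 -> R) : {poly R} :=
  'X^(n.+1) + \poly_(i < n.+1) c (inord i).

Lemma monic_of_coefsP c : [/\ monic_of_coefs c \is monic,
  size (monic_of_coefs c) = n.+2 & forall i : 'I_n.+1, (monic_of_coefs c)`_i = c i].
Proof.
have lts : (size (\poly_(i < n.+1) c (inord i)) < size ('X^(n.+1) : {poly R}))%N.
  by rewrite size_polyXn ltnS size_poly.
split; first by rewrite monicE lead_coefDl // lead_coefXn.
  by rewrite size_polyDl // size_polyXn.
by move=> i; rewrite coefD coefXn coef_poly ltn_ord inord_val ltn_eqF // add0r.
Qed.

Lemma controllable_companion A v : controllable A v ->
  exists p, [/\ p \is monic, size p = n.+2
    & A *m krylov_mx A v = krylov_mx A v *m left_companion n.+1 p].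
Proof.
move=> [K' [KK' K'K]]; rewrite -/(krylov_mx A v) in KK' K'K.
(* c holds the coordinates of A^(n+1) v in the Krylov basis; the last companion column is -p, hence
   the coefficients -c. *)
have [c cE] : exists c, c = K' *m (A ^+ n.+1 *m v) by eexists.
have [mp sp pE] := monic_of_coefsP (fun i => - c i 0).
exists (monic_of_coefs (fun i => - c i 0)); split=> //.
apply/col_matrixP=> j; set P := left_companion _ _.
rewrite col_mulmx col_krylov mulmxA mulmxE -exprS.
have [->|njm] := eqVneq j ord_max.
  rewrite col_mulmx col_left_companion_max.
  have -> : - \col_i (monic_of_coefs (fun i => - c i 0))`_i = c.
    by apply/colP=> k; rewrite !mxE pE opprK.
  by rewrite cE (mulmxA (krylov_mx A v)) KK' mul1mx.
have ltj := ltn_succ_not_max njm.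
by rewrite (@mul_mx_left_companion_lt _ _ _ (Ordinal ltj)) // col_krylov.
Qed.

Lemma observable_companion u A : observable u A ->
  exists p, [/\ p \is monic, size p = n.+2
    & observability_mx u A *m A = right_companion n.+1 p *m observability_mx u A].
Proof.
move=> [K' [KK' K'K]]; rewrite -/(observability_mx u A) in KK' K'K.
have [c cE] : exists c, c = u *m A ^+ n.+1 *m K' by eexists.
have [mp sp pE] := monic_of_coefsP (fun i => - c 0 i).
exists (monic_of_coefs (fun i => - c 0 i)); split=> //.
apply/row_matrixP=> i; set P := right_companion _ _.
rewrite row_mul row_observability -mulmxA mulmxE -exprSr.
have [->|nim] := eqVneq i ord_max.
  rewrite row_mul row_right_companion col_left_companion_max.
  have -> : (- \col_i (monic_of_coefs (fun i => - c 0 i))`_i)^T = c.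
    by apply/rowP=> k; rewrite !mxE pE opprK.
  by rewrite cE -mulmxA K'K mulmx1.
have lti := ltn_succ_not_max nim.
by rewrite (@mul_right_companion_mx_lt _ _ _ (Ordinal lti)) // row_observability.
Qed.

Lemma ract_small A v p : (size p <= n.+1)%N ->
  ract A v p = krylov_mx A v *m \col_(i < n.+1) p`_i.
Proof.
move=> lep; rewrite (ract_widen _ _ lep); apply/colP=> i; rewrite summxE mxE.
by apply: eq_bigr => j _; rewrite !mxE big_ord1 !mxE eqxx mulr1n.
Qed.

Lemma lact_small u A p : (size p <= n.+1)%N ->
  lact A u p = \row_(i < n.+1) p`_i *m observability_mx u A.
Proof.
move=> lep; rewrite (lact_widen _ _ lep) mulmx_sum_row.
by apply: eq_bigr => j _; rewrite mxE row_observability.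
Qed.

Lemma monic_sizeE p : p \is monic -> size p = n.+2 ->
  p = 'X^(n.+1) + \poly_(i < n.+1) p`_i.
Proof.
move=> mp sp; apply/polyP=> i; rewrite coefD coefXn coef_poly.
have [ltin|lein|->] := ltngtP i n.+1; rewrite ?add0r //.
  by rewrite nth_default // sp.
by rewrite addr0 -(monicP mp) lead_coefE sp.
Qed.

Lemma krylov_minpoly A v p : p \is monic -> size p = n.+2 -> controllable A v ->
  A *m krylov_mx A v = krylov_mx A v *m left_companion n.+1 p ->
  monic_right_generator (right_annihilator A v) p.
Proof.
move=> mp sp [K' [_ K'K]] AK; rewrite -/(krylov_mx A v) in K'K.
have vp : ract A v p = 0.
  (* The last column of A K = K C_l(p) expresses A^(n+1) v through lower powers, which is v . p =
     0. *)
  rewrite (monic_sizeE mp sp) ractD [ract A v (poly _ _)]ract_small ?size_poly //.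
  have -> : ract A v 'X^(n.+1) = col ord_max (A *m krylov_mx A v).
    by rewrite col_mulmx col_krylov mulmxA mulmxE -exprS ractXn.
  rewrite AK col_mulmx col_left_companion_max mulmxN addrC; apply/eqP.
  rewrite subr_eq0; apply/eqP; congr (_ *m _); apply/colP=> i.
  by rewrite !mxE coef_poly ltn_ord.
split=> // q; rewrite right_annihilatorE; split=> [vq|[s ->]]; last first.
  by rewrite ractM vp ract0l.
(* The remainder r also annihilates v and has at most n+1 coefficients, so K times its coefficient
   column is zero; K being invertible, r = 0. *)
have [s [r [qE ltr]]] := monic_left_division q mp; exists s.
rewrite qE ractD ractM vp ract0l add0r in vq.
rewrite sp ltnS in ltr; rewrite ract_small // in vq.
rewrite qE [X in _ + X](_ : r = 0) ?addr0 //; apply/polyP=> i; rewrite coef0.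
have [lti|] := ltnP i n.+1; last by move=> lei; rewrite nth_default // (leq_trans ltr).
have := congr1 (mulmx K') vq.
rewrite mulmxA K'K mul1mx mulmx0 => /colP/(_ (Ordinal lti)).
by rewrite !mxE.
Qed.

Lemma observability_minpoly u A p : p \is monic -> size p = n.+2 -> observable u A ->
  observability_mx u A *m A = right_companion n.+1 p *m observability_mx u A ->
  monic_left_generator (left_annihilator u A) p.
Proof.
move=> mp sp [K' [KK' _]] KA; rewrite -/(observability_mx u A) in KK'.
have up : lact A u p = 0.
  rewrite (monic_sizeE mp sp) lactD [lact A u (poly _ _)]lact_small ?size_poly //.
  have -> : lact A u 'X^(n.+1) = row ord_max (observability_mx u A *m A).
    by rewrite row_mul row_observability -mulmxA mulmxE -exprSr lactXn.
  rewrite KA row_mul row_right_companion col_left_companion_max linearN mulNmx addrC.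
  apply/eqP; rewrite subr_eq0; apply/eqP; congr (_ *m _); apply/rowP=> i.
  by rewrite !mxE coef_poly ltn_ord.
split=> // q; split=> [uq|[s ->]]; last first.
  by rewrite /left_annihilator -/(lact A u (s * p)) lactM up lact0l.
rewrite /left_annihilator -/(lact A u q) in uq.
(* This division puts the quotient to the left of p, the side needed for a left ideal. *)
exists (Pdiv.Ring.rdivp q p); rewrite {1}[q](Pdiv.RingMonic.rdivp_eq mp).
set r := Pdiv.Ring.rmodp q p.
have ltr : (size r < n.+2)%N by rewrite -sp Pdiv.Ring.ltn_rmodpN0 ?monic_neq0.
rewrite {1}[q](Pdiv.RingMonic.rdivp_eq mp) lactD lactM up lact0l add0r -/r in uq.
rewrite ltnS in ltr; rewrite lact_small // in uq.
rewrite [X in _ + X](_ : r = 0) ?addr0 //; apply/polyP=> i; rewrite coef0.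
have [lti|] := ltnP i n.+1; last by move=> lei; rewrite nth_default // (leq_trans ltr).
have := congr1 (mulmx^~ K') uq.
rewrite -mulmxA KK' mulmx1 mul0mx => /rowP/(_ (Ordinal lti)).
by rewrite !mxE.
Qed.

(** [epsilon] returns some monic generator once one exists, and uniqueness identifies it with p. *)
Lemma right_minpolyE A v p :
  monic_right_generator (right_annihilator A v) p -> right_minpoly A v = p.
Proof.
move=> gp; have := epsilon_spec (inhabits 0) _ (ex_intro _ p gp).
by move/monic_right_generator_unique; apply.
Qed.

Lemma left_minpolyE u A p :
  monic_left_generator (left_annihilator u A) p -> left_minpoly u A = p.
Proof.
move=> gp; have := epsilon_spec (inhabits 0) _ (ex_intro _ p gp).
by move/monic_left_generator_unique; apply.
Qed.

(* The Hankel matrix [p_(i+j+1)] intertwines the two companion matrices; with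
   its columns reversed it is upper unitriangular. *)
Lemma similar_left_right_companion p : p \is monic -> size p = n.+2 ->
  similar_mx (left_companion n.+1 p) (right_companion n.+1 p).
Proof.
move=> mp sp; pose H : 'M[R]_n.+1 := \matrix_(i, j) p`_(i + j).+1.
have pn1 : p`_n.+1 = 1 by have := monicP mp; rewrite lead_coefE sp.
have p_gt k : (n.+1 < k)%N -> p`_k = 0 by move=> ltk; rewrite nth_default // sp.
have [U' invU] : mx_invertible (\matrix_(i, j) H i (rev_ord j)).
  apply/elementary_product_inv/elementary_upper_unitriangular => i j leji.
  (* The entry at (i, j) is the coefficient of index i + (n - j) + 1: the leading one on the
     diagonal, beyond the degree below it. *)
  rewrite !mxE /= subSS; case: (eqVneq i j) => [->|nij].
    by rewrite subnKC // -ltnS.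
  have lejn : (j <= n)%N by rewrite -ltnS.
  apply: p_gt; rewrite ltnS (addnBA _ lejn) ltn_subRL ltn_add2r.
  by rewrite ltn_neqAle eq_sym nij.
have [H' invH] : mx_invertible H.
  (* Undoing the column reversal of H reverses the rows of the inverse. *)
  case: invU => UU' U'U; exists (\matrix_(i, j) U' (rev_ord i) j); split.
    apply/matrixP=> i j; rewrite -UU' !mxE (reindex_inj rev_ord_inj).
    by apply: eq_bigr => k _; rewrite !mxE rev_ordK.
  apply/matrixP=> i j; rewrite !mxE -(inj_eq rev_ord_inj).
  have := congr1 (fun M : 'M_n.+1 => M (rev_ord i) (rev_ord j)) U'U; rewrite !mxE => <-.
  by apply: eq_bigr => k _; rewrite !mxE rev_ordK.
exists H, H'; split=> //; apply: mx_inverse_conj invH _.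
have last_row (j : 'I_n.+1) : p`_(n + j).+1 = (j == 0 :> nat)%:R.
  case: j => -[|k] ltk /=; first by rewrite addn0 pn1.
  by rewrite addnS p_gt // ltnS ltnS leq_addr.
have shift (i j : 'I_n.+1) : \sum_(k < n) p`_(k + j).+1 *+ (i == k.+1 :> nat)
    = if i == 0 :> nat then 0 else p`_(i + j).
  case: i => -[|i] lti /=; first by rewrite big1.
  rewrite (bigD1 (Ordinal (lti : (i < n)%N))) //= eqxx big1 ?addr0 // => k nki.
  by rewrite eqSS eq_sym (negPf (nki : k != i :> nat)).
pose wd := widen_ord (leqnSn n).
apply/matrixP=> i j; rewrite !mxE !big_ord_recr /= !mxE /= eqxx.
have -> : \sum_(k < n) left_companion n.+1 p i (wd k) * H (wd k) j
    = \sum_(k < n) p`_(k + j).+1 *+ (i == k.+1 :> nat).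
  by apply: eq_bigr => k _; rewrite !mxE /= eqSS ltn_eqF // mulr_natl.
have -> : \sum_(k < n) H i (wd k) * right_companion n.+1 p (wd k) j
    = \sum_(k < n) p`_(k + i).+1 *+ (j == k.+1 :> nat).
  by apply: eq_bigr => k _; rewrite !mxE /= eqSS ltn_eqF // mulr_natr addnC.
(* Both products have entry p_(i+j) for i, j > 0, entry -p_0 at (0, 0), and 0 elsewhere. *)
rewrite !shift last_row [(i + n)%N]addnC last_row.
case: (i =P 0 :> nat) => [->|_]; case: (j =P 0 :> nat) => [->|_];
  rewrite ?(mulr1, mul1r, mulr0, mul0r, add0r, addr0, addn0, add0n, addrN) //.
by rewrite [(j + i)%N]addnC.
Qed.

End Companion.

(** * The pencil of a companion matrix *)

Section Pencil.
Variable R : nzRingType.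

Lemma map_polyC_elementary n (P : 'M[R]_n) :
  elementary_product P -> elementary_product (map_mx polyC P).
Proof.
elim=> {P} [|i j|i c [d [cd dc]]|i j c neq|P Q _ eP _ eQ].
- by rewrite map_mx1; constructor.
- by rewrite map_tperm_mx; constructor.
- have -> : map_mx polyC (scale_mx i c) = scale_mx i c%:P.
    rewrite map_diag_mx; congr diag_mx; apply/rowP=> j; rewrite !mxE.
    by case: ifP.
  by constructor; exists d%:P; rewrite -!polyCM cd dc.
- by rewrite map_mxD map_mx1 map_mxZ map_delta_mx; constructor.
- by rewrite map_mxM; constructor.
Qed.

Lemma last_column_reduction (S : nzRingType) n (M : 'M[S]_n.+1) :
  (forall i j, j != ord_max -> M i j = (i == j)%:R) ->
  exists2 V, elementary_product V & M *m V = last_diag_mx n (M ord_max ord_max).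
Proof.
move=> M1; pose c : 'M[S]_n.+1 :=
  \matrix_(i, j) (if (i != ord_max) && (j == ord_max) then - M i j else 0).
exists (1%:M + c).
  apply: (elementary_block_unipotent (D := predC1 ord_max)) => i j.
  by rewrite /= mxE negbK => /negPf ->.
(* The last row of c is zero, so its columns are combinations of basis vectors that M fixes. *)
have Mc : M *m c = c.
  apply/matrixP=> i j; rewrite mxE.
  have [->|nim] := eqVneq i ord_max.
    rewrite [RHS]mxE eqxx big1 // => k _; rewrite mxE.
    case: ifP => [/andP[nkm _]|_]; rewrite ?mulr0 //.
    by rewrite (M1 _ k) // eq_sym (negPf nkm) mul0r.
  rewrite (bigD1 i) //= (M1 i i) // eqxx mul1r big1 ?addr0 // => k nki.
  have [km|nkm] := eqVneq k ord_max; first by rewrite mxE km eqxx mulr0.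
  by rewrite (M1 i k) // eq_sym (negPf nki) mul0r.
rewrite mulmxDr mulmx1 Mc; apply/matrixP=> i j; rewrite !mxE.
have [->|njm] := eqVneq j ord_max; last first.
  rewrite andbF addr0 (M1 i j) //; have [->|//] := eqVneq i j.
  by rewrite (negPf njm).
by rewrite andbT; have [->|nim] := eqVneq i ord_max; rewrite /= ?addr0 ?subrr.
Qed.

(** z is central, so z I commutes with constant matrices and survives conjugation. *)
Lemma char_poly_mx_conj n (A B T T' : 'M[R]_n) : T *m T' = 1%:M ->
  A = T *m B *m T' ->
  char_poly_mx A = map_mx polyC T *m char_poly_mx B *m map_mx polyC T'.
Proof.
move=> TT' ->; rewrite /char_poly_mx mulmxBr mulmxBl -!map_mxM /=; congr (_ - _).
have -> : map_mx polyC T *m 'X%:M = 'X%:M *m map_mx polyC T.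
  apply/matrixP=> i j; rewrite !mxE (bigD1 j) //= big1 ?addr0 => [|k nkj]; last first.
    by rewrite !mxE (negPf nkj) mulr0.
  rewrite (bigD1 i) //= big1 ?addr0 => [|k nki]; last first.
    by rewrite !mxE eq_sym (negPf nki) mul0r.
  by rewrite !mxE !eqxx !mulr1n commr_polyX.
by rewrite -mulmxA -map_mxM TT' map_mx1 mulmx1.
Qed.

(** A signed permutation: row 0 goes to the bottom, every other row moves up one place and changes
    sign. It turns the columns -e_(j+1) of the reduced companion pencil into e_j. *)
Definition cyclic_shift_mx (S : nzRingType) n : 'M[S]_n.+1 :=
  \matrix_(k, i) if k == ord_max then (i == 0)%:R else - (i == k.+1 :> nat)%:R.

Lemma mul_cyclic_shift_mx (S : nzRingType) m n (W : 'M[S]_(n.+1, m)) k j :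
  (cyclic_shift_mx S n *m W) k j = if k == ord_max then W 0 j else - W (inord k.+1) j.
Proof.
rewrite mxE; have [->|nkm] := eqVneq k ord_max.
  rewrite (bigD1 0) //= big1 => [|i ni0]; rewrite mxE !eqxx.
    by rewrite mul1r addr0.
  by rewrite (negPf ni0) mul0r.
have k1 : (inord k.+1 : 'I_n.+1) = k.+1 :> nat by rewrite inordK // ltn_succ_not_max.
rewrite (bigD1 (inord k.+1)) //= big1 => [|i nik]; rewrite mxE (negPf nkm).
  by rewrite k1 eqxx mulN1r addr0.
by rewrite -k1 (inj_eq val_inj) (negPf nik) oppr0 mul0r.
Qed.

Lemma cyclic_shift_mx_inv n : cyclic_shift_mx R n *m (cyclic_shift_mx R n)^T = 1%:M.
Proof.
apply/matrixP=> k l; rewrite mul_cyclic_shift_mx !mxE.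
have [->|nkm] := eqVneq k ord_max.
  by have [_|nlm] := eqVneq l ord_max; rewrite ?eqxx // oppr0.
have k1 : (inord k.+1 : 'I_n.+1) = k.+1 :> nat by rewrite inordK // ltn_succ_not_max.
have [->|nlm] := eqVneq l ord_max; last by rewrite k1 opprK eqSS.
by rewrite -val_eqE /= k1 (negPf nkm) oppr0.
Qed.

Lemma map_cyclic_shift_mx n :
  map_mx polyC (cyclic_shift_mx R n) = cyclic_shift_mx {poly R} n.
Proof.
by apply/matrixP=> k i; rewrite !mxE; case: eqP => _; rewrite ?polyCN -polyC_natr.
Qed.

(** U carries out Horner's scheme on rows: U N has columns -e_(j+1) before the last one, and p in
    its top right corner. The signed shift moves p to the bottom right and leaves only the last
    column to clear. *)
Lemma companion_pencil n p : p \is monic -> size p = n.+2 ->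
  let N := char_poly_mx (left_companion n.+1 p) in
  exists U V, [/\ elementary_product U, elementary_product V &
    map_mx polyC (cyclic_shift_mx R n) *m (U *m N) *m V = last_diag_mx n p].
Proof.
move=> mp sp N.
pose U : 'M[{poly R}]_n.+1 := \matrix_(i, j) if (i <= j)%N then 'X^(j - i) else 0.
have eU : elementary_product U.
  apply: elementary_upper_unitriangular => i j; rewrite mxE leq_eqVlt.
  case/predU1P => [/val_inj ->|ltji]; first by rewrite leqnn subnn eqxx.
  by rewrite leqNgt ltji -val_eqE gtn_eqF.
pose W := U *m N.
have WE i j : W i j = \sum_k U i k * ('X *+ (k == j) - (left_companion n.+1 p k j)%:P).
  by rewrite mxE; apply: eq_bigr => k _; rewrite !mxE.
have W0 (i j : 'I_n.+1) : j != ord_max -> W i j = - (i == j.+1 :> nat)%:R.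
  move=> njm; have ltj := ltn_succ_not_max njm; pose j1 := Ordinal ltj.
  have Cj k : left_companion n.+1 p k j = (k == j1)%:R.
    by rewrite mxE ltn_eqF.
  have nj1j : j1 != j by rewrite -val_eqE /= gtn_eqF.
  (* Only k = j and k = j+1 contribute. For i <= j the two terms are the same power of z with
     opposite signs; for i = j+1 only -1 remains. *)
  rewrite WE (bigD1 j) // (bigD1 j1) //= big1 ?addr0 => [|k /andP[nkj nkj1]]; last first.
    by rewrite Cj (negPf nkj) (negPf nkj1) polyC0 subr0 mulr0.
  rewrite !Cj !eqxx (negPf nj1j) eq_sym (negPf nj1j).
  rewrite polyC0 subr0 mulr1n sub0r polyC1 mulrN1.
  rewrite !mxE /=; have [leij|ltji] := leqP i j.
    by rewrite leqW // -exprSr subSn // subrr ltn_eqF ?oppr0 ?ltnS.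
  rewrite mul0r add0r; have [leij1|ltj1i] := leqP i j.+1; last by rewrite gtn_eqF.
  have -> : i = j.+1 :> nat by apply/eqP; rewrite eqn_leq leij1.
  by rewrite subnn eqxx.
have Wp : W 0 ord_max = p.
  rewrite WE; under eq_bigr => k _ do
    rewrite !mxE eqxx /= subn0 polyCN opprK mulrDr mulrnAr -exprSr.
  rewrite big_split (bigD1 ord_max) //= big1 ?addr0 => [|k /negPf ->//].
  rewrite eqxx mulr1n {2}(monic_sizeE mp sp) poly_def; congr (_ + _).
  by apply: eq_bigr => k _; rewrite -mul_polyC commr_polyXn.
have [|V eV MV] := last_column_reduction (M := cyclic_shift_mx {poly R} n *m W).
  move=> i j njm; rewrite mul_cyclic_shift_mx; case: eqP => [->|/eqP nim].
    by rewrite W0 //= oppr0 [ord_max == j]eq_sym (negPf njm).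
  by rewrite W0 // opprK inordK ?ltn_succ_not_max // eqSS.
exists U, V; split=> //.
by rewrite map_cyclic_shift_mx -/W MV mul_cyclic_shift_mx eqxx Wp.
Qed.

End Pencil.

(** * The module presented by the pencil *)

Section Cokernel.
Variables (R : nzRingType) (n : nat) (A : 'M[R]_n).
Implicit Types (x y : 'cV[{poly R}]_n) (c : 'cV[R]_n).

(* The action of z extends the identity of R^n to R[z]^n -> R^n; its kernel is
   the image of z I - A. *)
Definition pencil_eval x : 'cV[R]_n := \sum_i ract A (delta_mx i 0) (x i 0).

Lemma pencil_evalD x y : pencil_eval (x + y) = pencil_eval x + pencil_eval y.
Proof. by rewrite -big_split; apply: eq_bigr => i _; rewrite mxE ractD. Qed.

Lemma pencil_evalN x : pencil_eval (- x) = - pencil_eval x.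
Proof. by rewrite -sumrN; apply: eq_bigr => i _; rewrite mxE ractN. Qed.

Lemma pencil_evalM x q : pencil_eval (x *m q%:M) = ract A (pencil_eval x) q.
Proof.
rewrite ract_suml; apply: eq_bigr => i _.
by rewrite mxE big_ord1 mxE eqxx ractM.
Qed.

Lemma pencil_evalC c : pencil_eval (map_mx polyC c) = c.
Proof.
apply/colP=> i; rewrite summxE (bigD1 i) //= big1 ?addr0 => [|j nji];
  by rewrite mxE ractC !mxE big_ord1 !mxE ?eqxx ?mul1r // eq_sym (negPf nji) mul0r.
Qed.

Lemma pencil_eval_image y : pencil_eval (char_poly_mx A *m y) = 0.
Proof.
rewrite mulmxBl pencil_evalD pencil_evalN.
suff -> : pencil_eval (map_mx polyC A *m y) = pencil_eval ('X%:M *m y) by rewrite subrr.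
(* Both A y and z y evaluate to the sum of the (A e_j) . y_j. *)
transitivity (\sum_j ract A (col j A) (y j 0)).
  rewrite /pencil_eval; under eq_bigr => i _ do rewrite mxE ract_sum.
  rewrite exchange_big; apply: eq_bigr => j _.
  have -> : col j A = \sum_i delta_mx i 0 *m (A i j)%:M.
    apply/colP=> i; rewrite summxE (bigD1 i) //= big1 ?addr0 => [|k nki];
    by rewrite !mxE big_ord1 !mxE ?eqxx ?mul1r // eq_sym (negPf nki) mul0r.
  by rewrite ract_suml; apply: eq_bigr => i _; rewrite mxE ractM ractC.
apply: eq_bigr => j _; rewrite mul_scalar_mx mxE ractM.
by rewrite -['X]mul1r ractMX (ractC A _ 1) mulmx1 colE.
Qed.

(** Division by z I - A with a constant remainder. The Horner step rests on c z = (z I - A) c + A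
    c. *)
Lemma pencil_division x :
  exists y c, x = char_poly_mx A *m y + map_mx polyC c.
Proof.
have -> : x = \sum_i delta_mx i 0 *m (x i 0)%:M.
  apply/colP=> i; rewrite summxE (bigD1 i) //= big1 ?addr0 => [|k nki];
    by rewrite !mxE big_ord1 !mxE ?eqxx ?mul1r // eq_sym (negPf nki) mul0r.
elim/big_ind: _ => [|x1 x2 [y1 [c1 ->]] [y2 [c2 ->]]|i _].
- by exists 0, 0; rewrite mulmx0 map_mx0 addr0.
- by exists (y1 + y2), (c1 + c2); rewrite mulmxDr map_mxD addrACA.
elim/poly_ind: (x i 0) => [|q a [y [c qE]]].
  by exists 0, 0; rewrite mulmx0 map_mx0 addr0 raddf0 mulmx0.
exists (y *m 'X%:M + map_mx polyC c), (A *m c + delta_mx i 0 *m a%:M).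
rewrite raddfD /= scalar_mxM [LHS]mulmxDr (mulmxA (delta_mx i 0)) qE.
rewrite mulmxDl mulmxDr !mulmxA -!addrA.
congr (_ + _); rewrite mulmxBl map_mxD !map_mxM map_delta_mx map_scalar_mx /=.
rewrite addrA subrK; congr (_ + _).
by apply/colP=> k; rewrite mul_scalar_mx !mxE big_ord1 !mxE eqxx mulr1n commr_polyX.
Qed.

(** Evaluation kills the multiple of the pencil and fixes the constant remainder, which must
    therefore be zero. *)
Lemma pencil_eval_eq0 x : pencil_eval x = 0 -> exists y, x = char_poly_mx A *m y.
Proof.
have [y [c ->]] := pencil_division x.
rewrite pencil_evalD pencil_eval_image add0r pencil_evalC => ->.
by exists y; rewrite map_mx0 addr0.
Qed.

End Cokernel.

(** * The cyclic vector given by a diagonal form of the pencil *)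

Section DiagonalPencil.
Variables (R : nzRingType) (n : nat) (A : 'M[R]_n.+1) (h : {poly R}).
Variables (P P' Q Q' : 'M[{poly R}]_n.+1).
Hypotheses (invP : mx_inverse P P') (invQ : mx_inverse Q Q').
Hypothesis (diagPQ : last_diag_mx n h = P *m char_poly_mx A *m Q).

(** The image in R^n of the generator of R[z] / h R[z], the only summand left by diag(1, ..., 1,
    h). *)
Let w := pencil_eval A (P' *m delta_mx ord_max 0).

Lemma diag_imageE : P' *m last_diag_mx n h = char_poly_mx A *m Q.
Proof. by rewrite diagPQ !mulmxA invP.2 mul1mx. Qed.

Lemma last_diag_delta : last_diag_mx n h *m delta_mx ord_max 0
  = delta_mx ord_max 0 *m h%:M :> 'cV_n.+1.
Proof.
apply/colP=> i; rewrite mul_diag_mx !mxE big_ord1 !mxE eqxx andbT mulr1n.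
by case: eqP => _; rewrite ?mulr1 ?mul1r ?mul0r.
Qed.

Lemma diag_pencil_generates c : exists q, c = ract A w q.
Proof.
have [x xE] : exists x, x = P *m map_mx polyC c by eexists.
pose q := x ord_max 0; exists q.
(* y is x without its last coordinate. The diagonal matrix fixes it, so P' y lies in the image of
   the pencil and evaluates to zero. *)
pose y := x - delta_mx ord_max 0 *m q%:M.
have yE : last_diag_mx n h *m y = y.
  have y0 : y ord_max 0 = 0 by rewrite /y !mxE big_ord1 !mxE !eqxx mul1r mulr1n subrr.
  apply/colP=> i; rewrite mul_diag_mx mxE [X in X * _]mxE.
  by case: eqP => [->|_]; rewrite ?mul1r // y0 mulr0.
rewrite -[LHS](pencil_evalC A) -[map_mx _ _]mul1mx -invP.2 -mulmxA -xE.
have -> : x = last_diag_mx n h *m y + delta_mx ord_max 0 *m q%:M by rewrite yE subrK.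
rewrite mulmxDr pencil_evalD (mulmxA P' (last_diag_mx n h)) diag_imageE -mulmxA.
by rewrite pencil_eval_image add0r mulmxA pencil_evalM.
Qed.

Lemma diag_pencil_annihilator q : ract A w q = 0 <-> exists s, q = h * s.
Proof.
split=> [|[s ->]]; last first.
  rewrite ractM -pencil_evalM -mulmxA -last_diag_delta mulmxA diag_imageE -mulmxA.
  by rewrite pencil_eval_image ract0l.
rewrite -pencil_evalM => /pencil_eval_eq0[y yE]; exists ((Q' *m y) ord_max 0).
(* Transporting yE by P puts q e_n in the image of the diagonal matrix; its last coordinate exhibits
   q as a right multiple of h. *)
have : delta_mx ord_max 0 *m q%:M = last_diag_mx n h *m (Q' *m y).
  rewrite diagPQ -(mulmxA (_ *m _)) (mulmxA Q) invQ.1 mul1mx -mulmxA -yE.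
  by rewrite !mulmxA invP.1 mul1mx.
move/colP/(_ ord_max); rewrite mul_diag_mx mxE big_ord1 !mxE !eqxx mul1r mulr1n.
by move=> ->.
Qed.

End DiagonalPencil.

(** * Cyclic matrices over a division ring *)

Section CyclicMatrices.
Variable F : unitRingType.
Hypothesis F_division : forall x : F, x != 0 -> x \is a GRing.unit.
Variables (n : nat) (A : 'M[F]_n.+1).

(** With d the degree of h, reduction modulo h makes the n+1 by d Krylov matrix K surjective, and
    the annihilator condition makes it injective. Invariance of dimension yields d = n+1, so K is
    the square controllability matrix. *)
Lemma generator_controllable w (h : {poly F}) :
  h \is monic -> (forall c, exists q, c = ract A w q) ->
  (forall q, ract A w q = 0 <-> exists s, q = h * s) -> controllable A w.
Proof.
move=> mh gen ann.
have [d sh] : exists d, size h = d.+1.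
  by exists (size h).-1; rewrite prednK // size_poly_gt0 monic_neq0.
pose K := \matrix_(i < n.+1, j < d) (A ^+ j *m w) i 0.
have actE (r : {poly F}) : (size r <= d)%N -> ract A w r = K *m \col_i r`_i.
  move=> ler; rewrite (ract_widen _ _ ler); apply/colP=> i; rewrite summxE mxE.
  by apply: eq_bigr => j _; rewrite !mxE big_ord1 !mxE eqxx mulr1n.
have small (j : 'I_n.+1) : exists s : {poly F},
    (size s <= d)%N /\ ract A w s = delta_mx j 0.
  have [q ->] := gen (delta_mx j 0).
  have [s [t [-> ltt]]] := monic_left_division q mh; exists t.
  rewrite ractD ractM (proj2 (ann h)) ?ract0l ?add0r; last by exists 1; rewrite mulr1.
  by split=> //; rewrite -ltnS -sh.
have [r rP] := fin_all_exists small.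
pose L := \matrix_(i < d, j < n.+1) (r j)`_i.
have KL : K *m L = 1%:M.
  apply/col_matrixP=> j; have [ler rj] := rP j.
  rewrite col_mulmx (_ : col j L = \col_i (r j)`_i).
    by rewrite -actE // rj colE mul1mx.
  by apply/colP=> i; rewrite !mxE.
(* A kernel vector is the coefficient column of a multiple of h of degree below d, hence zero. *)
have K_inj (b : 'cV_d) : K *m b = 0 -> b = 0.
  pose t := rVpoly b^T.
  have bE : b = \col_i t`_i by apply/colP=> i; rewrite !mxE coef_rVpoly_ord mxE.
  have letd : (size t <= d)%N by exact: size_poly.
  rewrite {1}bE -actE // => /ann[s tE].
  suff t0 : t = 0 by rewrite bE t0; apply/colP=> i; rewrite !mxE coef0.
  have [s0|s0] := eqVneq s 0; first by rewrite tE s0 mulr0.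
  move: letd; rewrite tE size_monicM // sh addSn /= => led.
  have := leq_trans (_ : d < d + size s)%N led.
  by rewrite ltnn -[X in (X < _)%N]addn0 ltn_add2l size_poly_gt0 s0 => /(_ isT).
have LK : L *m K = 1%:M.
  (* K (L K - 1) = 0, and K is injective on columns. *)
  apply/col_matrixP=> j; apply/eqP; rewrite -subr_eq0 -raddfB /=; apply/eqP/K_inj.
  by rewrite -col_mulmx mulmxBr mulmxA KL mul1mx mulmx1 subrr col0.
have dn : n.+1 = d.
  by apply/eqP; rewrite eqn_leq (mulmx1_leq F_division KL) (mulmx1_leq F_division LK).
by subst d; exists L.
Qed.

Lemma diagonal_pencil_cyclic h : h \is monic ->
  equivalent_mx (char_poly_mx A) (last_diag_mx n h) ->
  exists w, controllable A w /\ h = right_minpoly A w.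
Proof.
move=> mh /equivalent_mxP[P [Q [eP eQ hE]]].
have [P' invP] := elementary_product_inv eP.
have [Q' invQ] := elementary_product_inv eQ.
pose w := pencil_eval A (P' *m delta_mx ord_max 0); exists w.
have ann q : ract A w q = 0 <-> exists s, q = h * s.
  exact: diag_pencil_annihilator invP invQ hE q.
split; last by rewrite (@right_minpolyE _ _ _ _ h).
apply: (generator_controllable mh _ ann) => c.
exact: diag_pencil_generates invP hE c.
Qed.

Lemma companion_diagonal_pencil p : p \is monic -> size p = n.+2 ->
  similar_mx A (left_companion n.+1 p) ->
  equivalent_mx (char_poly_mx A) (last_diag_mx n p).
Proof.
move=> mp sp [T [T' [invT /(char_poly_mx_conj invT.1) AE]]].
have elem_map (S S' : 'M[F]_n.+1) :
    mx_inverse S S' -> elementary_product (map_mx polyC S).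
  by move=> /(mx_inverse_elementary F_division)/map_polyC_elementary.
have eT := elem_map _ _ invT; have eT' := elem_map _ _ (mx_inverse_sym invT).
have [U [V [eU eV <-]]] := companion_pencil mp sp.
set N := char_poly_mx (left_companion n.+1 p) in AE *.
have -> : N = map_mx polyC T' *m char_poly_mx A *m map_mx polyC T.
  rewrite AE !mulmxA -map_mxM invT.2 map_mx1 mul1mx -mulmxA -map_mxM invT.2.
  by rewrite map_mx1 mulmx1.
apply: equivalent_mx_trans (equivalent_elementary_col _ eV).
apply: equivalent_mx_trans (equivalent_elementary_row _ _); last first.
  (* The shift has constant entries, so its factorisation comes from elimination over F and is
     lifted to F[z], as for T and T'. *)
  exact: elem_map (right_invertible_inverse F_division (cyclic_shift_mx_inv F n)).
apply: equivalent_mx_trans (equivalent_elementary_row _ eU).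
apply: equivalent_mx_trans (equivalent_elementary_col _ eT).
exact: equivalent_elementary_row.
Qed.

End CyclicMatrices.

(** * From companion forms to cyclic vectors *)

Section CompanionCyclic.
Variables (R : nzRingType) (n : nat) (A : 'M[R]_n.+1) (p : {poly R}).
Variables (T T' : 'M[R]_n.+1).
Hypotheses (mp : p \is monic) (sp : size p = n.+2) (invT : mx_inverse T T').

Lemma left_companion_cyclic : A = T *m left_companion n.+1 p *m T' ->
  controllable A (T *m delta_mx 0 0) /\ p = right_minpoly A (T *m delta_mx 0 0).
Proof.
move=> AE; have AT : A *m T = T *m left_companion n.+1 p.
  by rewrite AE -mulmxA invT.2 mulmx1.
have TK := companion_krylov AT.
have cA : controllable A (T *m delta_mx 0 0).
  by exists T'; rewrite -/(krylov_mx A (T *m delta_mx 0 0)) -TK.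
split=> //; apply/esym/right_minpolyE/krylov_minpoly => //.
by rewrite -TK.
Qed.

Lemma right_companion_cyclic : A = T *m right_companion n.+1 p *m T' ->
  observable (delta_mx 0 0 *m T') A /\ p = left_minpoly (delta_mx 0 0 *m T') A.
Proof.
move=> AE; have AT : T' *m A = right_companion n.+1 p *m T'.
  by rewrite AE !mulmxA invT.2 mul1mx.
have TK := companion_observability AT.
have oA : observable (delta_mx 0 0 *m T') A.
  by exists T; rewrite -/(observability_mx (delta_mx 0 0 *m T') A) -TK; case: invT.
split=> //; apply/esym/left_minpolyE/observability_minpoly => //.
by rewrite -TK.
Qed.

End CompanionCyclic.

(** * From cyclic vectors to companion forms *)

Section CyclicCompanion.
Variables (R : nzRingType) (n : nat) (A : 'M[R]_n.+1).

Lemma controllable_similar v : controllable A v ->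
  [/\ right_minpoly A v \is monic, size (right_minpoly A v) = n.+2
    & similar_mx A (left_companion n.+1 (right_minpoly A v))].
Proof.
move=> cA; have [p [mp sp AK]] := controllable_companion cA.
rewrite (right_minpolyE (krylov_minpoly mp sp cA AK)); split=> //.
case: cA => K' invK; exists (krylov_mx A v), K'.
by split=> //; apply: mx_inverse_conj AK.
Qed.

Lemma observable_similar u : observable u A ->
  [/\ left_minpoly u A \is monic, size (left_minpoly u A) = n.+2
    & similar_mx A (right_companion n.+1 (left_minpoly u A))].
Proof.
move=> oA; have [p [mp sp KA]] := observable_companion oA.
rewrite (left_minpolyE (observability_minpoly mp sp oA KA)); split=> //.
case: oA => K' invK; exists K', (observability_mx u A).
by split; [exact: mx_inverse_sym | apply: mx_inverse_conjr KA].
Qed.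

End CyclicCompanion.

Theorem theorem4p1 (F : unitRingType)
    (F_division : forall x : F, x != 0 -> x \is a GRing.unit)
    (n : nat) (A : 'M[F]_n.+1) :
  [<-> exists v : 'cV[F]_n.+1, controllable A v;
       exists u : 'rV[F]_n.+1, observable u A;
       exists p : {poly F},
         [/\ p \is monic, size p = n.+2
           & similar_mx A (left_companion n.+1 p)
             \/ similar_mx A (right_companion n.+1 p)];
       exists h : {poly F},
         h \is monic /\ equivalent_mx (char_poly_mx A) (last_diag_mx n h)]
  /\
  ((exists v : 'cV[F]_n.+1, controllable A v) ->
   [/\ (* (a) *)
       forall (v : 'cV[F]_n.+1) (u : 'rV[F]_n.+1),
         controllable A v -> observable u A ->
         [/\ size (right_minpoly A v) = n.+2,
             size (left_minpoly u A) = n.+2,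
             similar_mx A (left_companion n.+1 (right_minpoly A v))
           & similar_mx (left_companion n.+1 (right_minpoly A v))
                        (right_companion n.+1 (left_minpoly u A))],
       (* (b), with T' = T^-1 and S' = S^-1 *)
       forall (f g : {poly F}) (T T' S S' : 'M[F]_n.+1),
         f \is monic -> size f = n.+2 ->
         g \is monic -> size g = n.+2 ->
         mx_inverse T T' -> mx_inverse S S' ->
         A = T *m left_companion n.+1 f *m T' ->
         A = S *m right_companion n.+1 g *m S' ->
         let v : 'cV[F]_n.+1 := T *m delta_mx 0 0 in
         let u : 'rV[F]_n.+1 := delta_mx 0 0 *m S' in
         [/\ controllable A v, observable u A,
             f = right_minpoly A v & g = left_minpoly u A]
     & (* (c) *)
       forall h : {poly F},
         h \is monic ->
         equivalent_mx (char_poly_mx A) (last_diag_mx n h) ->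
         exists w : 'cV[F]_n.+1, controllable A w /\ h = right_minpoly A w]).
Proof.
have similar_observable (B : 'M[F]_n.+1) p : p \is monic -> size p = n.+2 ->
    similar_mx B (right_companion n.+1 p) -> exists u, observable u B.
  move=> mp sp [T [T' [invT BE]]]; exists (delta_mx 0 0 *m T').
  exact: (right_companion_cyclic mp sp invT BE).1.
split.
  (* The implications run in a cycle. The passage from (1) to (2) changes sides through the Hankel
     similarity, and (3) uses it again to reduce a right companion matrix to a left one. *)
  tfae.
  - move=> [v /controllable_similar[mp sp sim]].
    apply: (similar_observable _ _ mp sp).
    exact: similar_mx_trans sim (similar_left_right_companion mp sp).
  - move=> [u /observable_similar[mp sp sim]].
    by exists (left_minpoly u A); split=> //; right.
  - move=> [p [mp sp sim]]; exists p; split=> //.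
    apply: companion_diagonal_pencil => //; case: sim => // sim.
    apply: similar_mx_trans sim (similar_mx_sym _).
    exact: similar_left_right_companion.
  - move=> [h [mh /(diagonal_pencil_cyclic F_division mh)[w [cw _]]]].
    by exists w.
move=> _; split.
- move=> v u /controllable_similar[mp sp simv] /observable_similar[mq sq simu].
  by split=> //; apply: similar_mx_trans (similar_mx_sym simv) simu.
- move=> f g T T' S S' mf sf mg sg invT invS AT AS v u.
  have [cv fE] := left_companion_cyclic mf sf invT AT.
  by have [ou gE] := right_companion_cyclic mg sg invS AS.
- move=> h mh; exact: diagonal_pencil_cyclic.
Qed.
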